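(* Let $T>0$, $h>0$, $\gamma>1/2$, $x\in\mathcal C_1^{\gamma}([0,T];\mathbb R^d)$, $\lambda\in(1/2,\gamma)$ and $\xi\in\mathcal C_1^{\lambda}([-h,0];\mathbb R^n)$. Let $f:\mathcal C_1^{\lambda}([-h,0];\mathbb R^n)\to\mathbb R^{n\times d}$ satisfy the following two conditions. (i) There is a constant $M>0$ such that $|f(\zeta)|\le M$ and $|f(\zeta_2)-f(\zeta_1)|\le M\sup_{\theta\in[-h,0]}|\zeta_2(\theta)-\zeta_1(\theta)|$ for all $\zeta,\zeta_1,\zeta_2\in\mathcal C_1^{\lambda}([-h,0];\mathbb R^n)$. (ii) For every $N\ge1$ there is a constant $c_N>0$ such that $$\|\mathcal U^{(a)}(Z_1)-\mathcal U^{(a)}(Z_2)\|_{\lambda,[a_1,a_2]}\le c_N\|Z_1-Z_2\|_{\lambda,[a_1-h,a_2]}$$ for all $0\le a_1\le a_2\le T$, all $\rho\in\mathcal C_1^\lambda([a_1-h,a_1];\mathbb R^n)$ and all $Z_1,Z_2\in\mathcal C^{\lambda}_{\rho,a_1,a_2}(\mathbb R^n)$ with $\max\{\|Z_1\|_{\lambda,[a_1-h,a_2]},\|Z_2\|_{\lambda,[a_1-h,a_2]}\}\le N$. Let $y\in\mathcal C^{\lambda}_{\xi,0,T}(\mathbb R^n)$ be the solution of $$y_t=\xi_0+\int_0^t f(\mathcal Z^y_u)\,dx_u,\quad t\in[0,T],\qquad \mathcal Z^y_0=\xi.$$ Then there exists a constant $c=c(\gamma,\lambda,M,T)>0$, depending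 only on the indicated quantities, such that $$\|y\|_{\lambda,[-h,T]}\le c\,\max\Big[\|\xi\|_{\lambda},\ \|x\|_{\gamma}^{\lambda/(\gamma+\lambda-1)},\ \|x\|_\gamma\Big].$$
   Context: $\mathcal C_1^\mu([a,b];V)$ is the space of continuous $g:[a,b]\to V$ with $\|g\|_{\mu,[a,b]}=\sup_{s\ne t\in[a,b]}|g_t-g_s|/|t-s|^\mu<\infty$; here $\|\xi\|_\lambda=\|\xi\|_{\lambda,[-h,0]}$ and $\|x\|_\gamma=\|x\|_{\gamma,[0,T]}$. For $\rho\in\mathcal C_1^\mu([a_1-h,a_1];V)$, $\mathcal C^\mu_{\rho,a_1,a_2}(V)=\{\zeta\in\mathcal C_1^\mu([a_1-h,a_2];V):\zeta=\rho\text{ on }[a_1-h,a_1]\}$. For a function $y$ defined on an interval containing $[t-h,t]$, $\mathcal Z^y_t:[-h,0]\to\mathbb R^n$ is $\mathcal Z^y_t(s)=y_{t+s}$. For $a=(a_1,a_2)$ and $Z\in\mathcal C_1^\lambda([a_1-h,a_2];\mathbb R^n)$, $[\mathcal U^{(a)}Z]_s=f(\mathcal Z^Z_s)$ for $s\in[a_1,a_2]$. Integrals with respect to $x$ are Young integrals: $\int_s^t g_u\,dx_u=\lim\sum_i g_{t_i}(x_{t_{i+1}}-x_{t_i})$ over partitions of $[s,t]$ with mesh tending to $0$. *)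

(* Defs.v *)
From mathcomp Require Export all_boot all_order all_algebra.
From mathcomp Require Export all_classical all_reals all_analysis.
Export Order.TTheory GRing.Theory Num.Theory.
Export numFieldNormedType.Exports.

Set Implicit Arguments.
Unset Strict Implicit.
Unset Printing Implicit Defensive.

Local Open Scope classical_set_scope.
Local Open Scope ring_scope.

(* The Euclidean norm of R^m (n = 1) and of R^(m x n): unlike the library's
   entrywise maximum norm, it satisfies |A *m v| <= |A| |v| with no
   dimensional factor. *)
Definition enorm (R : realType) (m n : nat) (A : 'M[R]_(m, n)) : R :=
  Num.sqrt (\sum_i \sum_j A i j ^+ 2).

(* A function on [a, b] is represented by a total function of which only the
   values on [a, b] matter. *)

(* The supremum is taken in \bar R, so that it is +oo when it is not finite.
   The maximum with 0 only matters for an empty family (b <= a), whose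
   ereal_sup would be -oo. *)
Definition holder_norm (R : realType) (m n : nat) (mu a b : R)
    (g : R -> 'M[R]_(m, n)) : \bar R :=
  maxe 0%E (ereal_sup [set r : \bar R | exists s t : R,
    [/\ a <= s <= b, a <= t <= b, s != t &
        r = (enorm (g t - g s) / `|t - s| `^ mu)%:E]]).

Definition holder (R : realType) (m n : nat) (mu a b : R)
    (g : R -> 'M[R]_(m, n)) : Prop :=
  {within `[a, b], continuous g} /\ (holder_norm mu a b g < +oo)%E.

Definition sup_norm (R : realType) (m n : nat) (a b : R)
    (g : R -> 'M[R]_(m, n)) : \bar R :=
  ereal_sup [set (enorm (g t))%:E | t in `[a, b]].

Definition holder_ext (R : realType) (n : nat) (mu h : R) (rho : R -> 'cV[R]_n)
    (a1 a2 : R) (zeta : R -> 'cV[R]_n) : Prop :=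
  holder mu (a1 - h) a2 zeta /\
  (forall t : R, a1 - h <= t <= a1 -> zeta t = rho t).

(* Only the values of [segment y t] on [-h, 0] matter. *)
Definition segment (R : realType) (V : Type) (y : R -> V) (t : R) : R -> V :=
  fun s => y (t + s).

Definition Uop (R : realType) (n d : nat)
    (f : (R -> 'cV[R]_n) -> 'M[R]_(n, d)) (Z : R -> 'cV[R]_n) :
    R -> 'M[R]_(n, d) :=
  fun s => f (segment Z s).

(* As in the library's [variation], a partition a = t_0 < ... < t_k = b is
   encoded by the sequence [:: t_1; ...; t_k], and its i-th point is
   nth b (a :: p) i. *)
Definition young_sum (R : realType) (n d : nat) (g : R -> 'M[R]_(n, d))
    (x : R -> 'cV[R]_d) (a b : R) (p : seq R) : 'cV[R]_n :=
  let t := nth b (a :: p) in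
  \sum_(0 <= i < size p) (g (t i) *m (x (t i.+1) - x (t i))).

Definition mesh_lt (R : realType) (a b : R) (p : seq R) (delta : R) : Prop :=
  let t := nth b (a :: p) in
  forall i : nat, (i < size p)%N -> t i.+1 - t i < delta.

Definition is_young_integral (R : realType) (n d : nat)
    (g : R -> 'M[R]_(n, d)) (x : R -> 'cV[R]_d) (a b : R) (I : 'cV[R]_n) :
    Prop :=
  forall eps : R, 0 < eps -> exists2 delta : R, 0 < delta &
    forall p : seq R, itv_partition a b p -> mesh_lt a b p delta ->
      enorm (young_sum g x a b p - I) < eps.

Definition delay_solution (R : realType) (n d : nat) (lambda h T : R)
    (x : R -> 'cV[R]_d) (xi : R -> 'cV[R]_n)
    (f : (R -> 'cV[R]_n) -> 'M[R]_(n, d)) (y : R -> 'cV[R]_n) : Prop :=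
  [/\ holder_ext lambda h xi 0 T y,
      forall t : R, 0 <= t <= T -> exists2 I : 'cV[R]_n,
        is_young_integral (fun u => f (segment y u)) x 0 t I &
        y t = xi 0 + I
    & forall s : R, - h <= s <= 0 -> segment y 0 s = xi s].

(* Since h >= 0, the Lipschitz bound forces f zeta to depend only on the
   restriction of zeta to [-h, 0]: f is a function on C^lambda([-h, 0]; R^n). *)
Definition bounded_lipschitz (R : realType) (n d : nat) (lambda h M : R)
    (f : (R -> 'cV[R]_n) -> 'M[R]_(n, d)) : Prop :=
  (forall zeta : R -> 'cV[R]_n, holder lambda (- h) 0 zeta ->
     enorm (f zeta) <= M) /\
  (forall zeta1 zeta2 : R -> 'cV[R]_n,
     holder lambda (- h) 0 zeta1 -> holder lambda (- h) 0 zeta2 ->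
     ((enorm (f zeta2 - f zeta1))%:E <=
        M%:E * sup_norm (- h) 0 (zeta2 \- zeta1)%R)%E).

Definition locally_lipschitz_Uop (R : realType) (n d : nat) (lambda h T : R)
    (f : (R -> 'cV[R]_n) -> 'M[R]_(n, d)) : Prop :=
  forall N : R, 1 <= N -> exists2 cN : R, 0 < cN &
    forall (a1 a2 : R) (rho Z1 Z2 : R -> 'cV[R]_n),
      0 <= a1 -> a1 <= a2 -> a2 <= T ->
      holder lambda (a1 - h) a1 rho ->
      holder_ext lambda h rho a1 a2 Z1 ->
      holder_ext lambda h rho a1 a2 Z2 ->
      (maxe (holder_norm lambda (a1 - h) a2 Z1)
            (holder_norm lambda (a1 - h) a2 Z2) <= N%:E)%E ->
      (holder_norm lambda a1 a2 (Uop f Z1 \- Uop f Z2)%R <=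
         cN%:E * holder_norm lambda (a1 - h) a2 (Z1 \- Z2)%R)%E.

(* Main.v *)
(* Write X for the Hoelder constant of x, N for that of y on [-h, T] and
   g u = f (Z^y_u), so that |g| <= M and g has lambda-Hoelder constant M N.
   On [s, t] of length L the Young sum S_m over m equal pieces satisfies
   |S_m| <= M X L^gamma m^(1 - gamma), and halving the pieces gives
   |S_(2m) - S_m| <= M N X L^(lambda + gamma) m^(1 - lambda - gamma), which
   sums geometrically along m, 2m, 4m, ... since lambda + gamma > 1.  With m of
   order X^(1 / (gamma + lambda - 1)), independent of s and t, the term in N is
   at most (N / 2) L^lambda and, N being finite, is absorbed.  The remaining
   term X m^(1 - gamma) produces the exponent lambda / (gamma + lambda - 1). *)
Require Import Defs.
From mathcomp Require Import lra ring.

Set Implicit Arguments.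
Unset Strict Implicit.
Unset Printing Implicit Defensive.

Local Open Scope ring_scope.

(** * The Euclidean norm of matrices *)

(** By Lagrange's identity, the double sum of [(a i * b j - a j * b i) ^+ 2] is twice the defect of
    the squared inequality. *)
Lemma cauchy_schwarz_sum (R : rcfType) (I : finType) (a b : I -> R) :
  \sum_i a i * b i <= Num.sqrt (\sum_i a i ^+ 2) * Num.sqrt (\sum_i b i ^+ 2).
Proof.
have a2_ge0 : 0 <= \sum_i a i ^+ 2 by apply: sumr_ge0 => i _; exact: sqr_ge0.
have b2_ge0 : 0 <= \sum_i b i ^+ 2 by apply: sumr_ge0 => i _; exact: sqr_ge0.
have lagrange : 0 <= \sum_i \sum_j (a i * b j - a j * b i) ^+ 2.
  by apply: sumr_ge0 => i _; apply: sumr_ge0 => j _; exact: sqr_ge0.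
have lagrangeE : \sum_i \sum_j (a i * b j - a j * b i) ^+ 2 =
    2 * ((\sum_i a i ^+ 2) * (\sum_i b i ^+ 2) - (\sum_i a i * b i) ^+ 2).
  rewrite mulrBr expr2 mulr2n !mulrDl !mul1r.
  rewrite [X in _ + X - _]mulrC !mulr_suml -!big_split -sumrB /=.
  apply: eq_bigr => i _.
  rewrite !mulr_sumr -!big_split -sumrB /=.
  by apply: eq_bigr => j _; ring.
rewrite lagrangeE pmulr_rge0 // subr_ge0 in lagrange.
rewrite -sqrtrM // (le_trans (ler_norm _)) // -sqrtr_sqr.
by rewrite ler_sqrt // mulr_ge0.
Qed.

(** A single sum over pairs of indices is the form to which [cauchy_schwarz_sum] applies. *)
Lemma enormE (R : realType) (m n : nat) (A : 'M[R]_(m, n)) :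
  enorm A = Num.sqrt (\sum_(p : 'I_m * 'I_n) A p.1 p.2 ^+ 2).
Proof. by rewrite /enorm pair_big. Qed.

Lemma enorm_ge0 (R : realType) (m n : nat) (A : 'M[R]_(m, n)) : 0 <= enorm A.
Proof. exact: sqrtr_ge0. Qed.

Lemma sqr_enorm (R : realType) (m n : nat) (A : 'M[R]_(m, n)) :
  enorm A ^+ 2 = \sum_i \sum_j A i j ^+ 2.
Proof.
rewrite sqr_sqrtr //; apply: sumr_ge0 => i _.
by apply: sumr_ge0 => j _; exact: sqr_ge0.
Qed.

Lemma enorm0 (R : realType) (m n : nat) : enorm (0 : 'M[R]_(m, n)) = 0.
Proof.
rewrite /enorm big1 ?sqrtr0 // => i _.
by rewrite big1 // => j _; rewrite mxE expr0n.
Qed.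

Lemma enormN (R : realType) (m n : nat) (A : 'M[R]_(m, n)) :
  enorm (- A) = enorm A.
Proof.
rewrite /enorm; congr Num.sqrt; apply: eq_bigr => i _.
by apply: eq_bigr => j _; rewrite mxE sqrrN.
Qed.

Lemma enorm_distC (R : realType) (m n : nat) (A B : 'M[R]_(m, n)) :
  enorm (A - B) = enorm (B - A).
Proof. by rewrite -enormN opprB. Qed.

Lemma enormD (R : realType) (m n : nat) (A B : 'M[R]_(m, n)) :
  enorm (A + B) <= enorm A + enorm B.
Proof.
rewrite -(ler_pXn2r (ltn0Sn 1)) ?nnegrE ?addr_ge0 ?enorm_ge0 //.
rewrite sqrrD !sqr_enorm !pair_big /=.
under eq_bigr do rewrite mxE sqrrD.
rewrite 2!big_split lerD2r lerD2l sumrMnl lerMn2r /= !enormE.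
exact: cauchy_schwarz_sum.
Qed.

Lemma enorm_sum (R : realType) (m n : nat) (I : Type) (r : seq I)
    (P : pred I) (A : I -> 'M[R]_(m, n)) :
  enorm (\sum_(i <- r | P i) A i) <= \sum_(i <- r | P i) enorm (A i).
Proof.
elim: r => [|i r IHr]; first by rewrite !big_nil enorm0.
rewrite !big_cons; case: ifP => // _.
by rewrite (le_trans (enormD _ _)) // lerD2l.
Qed.

(** Cauchy-Schwarz bounds the entry (i, k) by row i of [A] and column k of [B]; squaring and summing
    over i and k gives the product. *)
Lemma enormM (R : realType) (m n p : nat) (A : 'M[R]_(m, n))
    (B : 'M[R]_(n, p)) :
  enorm (A *m B) <= enorm A * enorm B.
Proof.
rewrite -(ler_pXn2r (ltn0Sn 1)) ?nnegrE ?mulr_ge0 ?enorm_ge0 //.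
rewrite exprMn !sqr_enorm mulr_suml; apply: ler_sum => i _.
rewrite [X in _ <= _ * X]exchange_big mulr_sumr; apply: ler_sum => k _.
have sq_ge0 (F : 'I_n -> R) : 0 <= \sum_j F j ^+ 2.
  by apply: sumr_ge0 => j _; exact: sqr_ge0.
(* Only the squares of [F] are prescribed, so this serves both row i of [A] and its opposite, hence
   bounds an absolute value. *)
have CS (F : 'I_n -> R) : (forall j, F j ^+ 2 = A i j ^+ 2) ->
    \sum_j F j * B j k <= Num.sqrt ((\sum_j A i j ^+ 2) * (\sum_j B j k ^+ 2)).
  move=> FA; rewrite sqrtrM //.
  by under [X in Num.sqrt X * _]eq_bigr do rewrite -FA; exact: cauchy_schwarz_sum.
rewrite mxE -real_normK ?num_real //.
rewrite -[leRHS]sqr_sqrtr ?mulr_ge0 //.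
rewrite ler_pXn2r ?nnegrE ?sqrtr_ge0 // ler_norml CS // andbT lerNl -sumrN.
rewrite (eq_bigr (fun j => - A i j * B j k)) => [|j _]; last by rewrite mulNr.
by apply: CS => j; rewrite sqrrN.
Qed.

(** * Hölder constants as real numbers *)

Definition holder_on (R : realType) (m n : nat) (mu a b K : R)
    (g : R -> 'M[R]_(m, n)) : Prop :=
  forall s t, a <= s <= b -> a <= t <= b -> s < t ->
    enorm (g t - g s) <= K * (t - s) `^ mu.

(** The conjunct [0 <= K] reflects the maximum with 0 in [holder_norm]; ordered pairs suffice
    because the quotient is symmetric in s and t. *)
Lemma holder_norm_leP (R : realType) (m n : nat) (mu a b K : R)
    (g : R -> 'M[R]_(m, n)) :
  (holder_norm mu a b g <= K%:E)%E <->
  0 <= K /\ holder_on mu a b K g.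
Proof.
rewrite /holder_norm ge_max; split.
  move=> /andP[K_ge0 gK]; split; first by rewrite -lee_fin.
  move=> s t sab tab st; have ts_gt0 : 0 < t - s by rewrite subr_gt0.
  rewrite -ler_pdivrMr ?powR_gt0 // -lee_fin -[t - s]gtr0_norm //.
  apply: le_trans gK; apply: ereal_sup_ubound; exists s, t; split=> //.
  by rewrite lt_eqF.
move=> [K_ge0 gK]; rewrite lee_fin K_ge0.
apply: ge_ereal_sup => _ [s [t [sab tab st ->]]].
have ts_gt0 : 0 < `|t - s| by rewrite normr_gt0 subr_eq0 eq_sym.
rewrite lee_fin ler_pdivrMr ?powR_gt0 //.
have [lt_st|lt_ts|eq_st] := ltgtP s t; last by rewrite eq_st eqxx in st.
  by rewrite gtr0_norm ?subr_gt0 // gK.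
by rewrite enorm_distC ltr0_norm ?subr_lt0 // opprB gK.
Qed.

Lemma holder_norm_fin (R : realType) (m n : nat) (mu a b : R)
    (g : R -> 'M[R]_(m, n)) :
  holder mu a b g -> exists K, holder_norm mu a b g = K%:E.
Proof.
move=> [_]; have : (0 <= holder_norm mu a b g)%E by rewrite /holder_norm le_max lexx.
by case: holder_norm => // K _ _; exists K.
Qed.

(** Makes the hypotheses on [f] applicable to the segments of a solution. *)
Lemma holder_segment (R : realType) (n : nat) (mu a b h u : R)
    (y : R -> 'cV[R]_n) :
  a <= u - h -> u <= b -> holder mu a b y -> holder mu (- h) 0 (segment y u).
Proof.
move=> au ub hy; have mem s : - h <= s <= 0 -> a <= u + s <= b.
  by move=> /andP[hs s0]; apply/andP; split; lra.
split.
  apply/subspace_continuousP => s; rewrite /= in_itv /= => /mem us.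
  have /subspace_continuousP/(_ (u + s)) := hy.1.
  rewrite /= in_itv /= => /(_ us) yc.
  move=> P /yc nP.
  (* Both relative neighbourhood filters are unfolded, since translation by u carries a ball about s
     to the ball of the same radius about u + s. *)
  have /nbhs_ballP[e e_gt0 eP] :
    nbhs (u + s : R) (fun r : R => r \in `[a, b] -> P (y r)) by exact: nP.
  suff : nbhs (s : R) (fun r : R => r \in `[- h, 0] -> P (y (u + r))) by [].
  apply/nbhs_ballP; exists e => //= r sr; rewrite in_itv /= => /mem ur.
  apply: eP; last by rewrite in_itv.
  by move: sr; rewrite /ball /= opprD addrACA subrr add0r.
have [K yK] := holder_norm_fin hy.
have /holder_norm_leP[K_ge0 {}yK] : (holder_norm mu a b y <= K%:E)%E by rewrite yK.
apply: (@le_lt_trans _ _ K%:E); last exact: ltry.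
apply/holder_norm_leP; split=> // s t /mem us /mem ut st.
have := yK _ _ us ut; rewrite ltrD2l => /(_ st).
by rewrite (_ : u + t - (u + s) = t - s) //; ring.
Qed.

(** * Young sums and uniform partitions *)

Lemma young_sum_cons (R : realType) (n d : nat) (g : R -> 'M[R]_(n, d))
    (x : R -> 'cV[R]_d) (a b u : R) (p : seq R) :
  young_sum g x a b (u :: p) = g a *m (x u - x a) + young_sum g x u b p.
Proof. by rewrite /young_sum /= big_nat_recl. Qed.

Lemma young_sum_nil (R : realType) (n d : nat) (g : R -> 'M[R]_(n, d))
    (x : R -> 'cV[R]_d) (a b : R) : young_sum g x a b [::] = 0.
Proof. by rewrite /young_sum big_geq. Qed.

(** Used to recover the integral over [s, t] from integrals that start at a common point. *)
Lemma young_sum_cat (R : realType) (n d : nat) (g : R -> 'M[R]_(n, d))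
    (x : R -> 'cV[R]_d) (a b c : R) (p q : seq R) :
  young_sum g x a c (p ++ q) =
  young_sum g x a b p + young_sum g x (last a p) c q.
Proof.
elim: p a => [|u p IHp] a; first by rewrite young_sum_nil add0r.
by rewrite cat_cons !young_sum_cons IHp addrA.
Qed.

(** In the form of a [path], the mesh condition passes through concatenation and weakening. *)
Lemma mesh_ltP (R : realType) (a b delta : R) (p : seq R) :
  mesh_lt a b p delta <-> path (fun u v => v - u < delta) a p.
Proof. by split=> [H|/(pathP b)//]; apply/(pathP b). Qed.

Definition uniform_partition (R : realType) (a b : R) (m : nat) : seq R :=
  [seq a + (b - a) / m%:R * i%:R | i <- iota 1 m].

(** The nodes are explicit functions of the index, so that even and odd nodes can be separated when
    the pieces are halved. *)
Definition uniform_sum (R : realType) (n d : nat) (g : R -> 'M[R]_(n, d))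
    (x : R -> 'cV[R]_d) (a b : R) (m : nat) : 'cV[R]_n :=
  let t (i : nat) := a + (b - a) / m%:R * i%:R in
  \sum_(0 <= i < m) g (t i) *m (x (t i.+1) - x (t i)).

Lemma nth_uniform_partition (R : realType) (a b c : R) (m i : nat) : (i <= m)%N ->
  nth c (a :: uniform_partition a b m) i = a + (b - a) / m%:R * i%:R.
Proof.
case: i => [|i im]; first by rewrite mulr0 addr0.
by rewrite /= (nth_map 0%N) ?size_iota // nth_iota.
Qed.

Lemma size_uniform_partition (R : realType) (a b : R) (m : nat) :
  size (uniform_partition a b m) = m.
Proof. by rewrite size_map size_iota. Qed.

Lemma last_uniform_partition (R : realType) (a b : R) (m : nat) : (0 < m)%N ->
  last a (uniform_partition a b m) = b.
Proof.
move=> m_gt0; have <- : nth a (a :: uniform_partition a b m) m =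
    last a (uniform_partition a b m).
  by rewrite -[in RHS](last_cons a) -nth_last /= size_uniform_partition.
by rewrite nth_uniform_partition // divfK ?pnatr_eq0 ?gtn_eqF // subrKC.
Qed.

(** The relation is arbitrary so as to cover both strict monotonicity and the mesh bound. *)
Lemma path_uniform_partition (R : realType) (e : rel R) (a b : R) (m : nat) :
  (forall u, e u (u + (b - a) / m%:R)) -> path e a (uniform_partition a b m).
Proof.
move=> ee; apply/(pathP a) => i; rewrite size_uniform_partition => im.
rewrite nth_uniform_partition ?(ltnW im) //.
rewrite -[nth _ _ i]/(nth a (a :: uniform_partition a b m) i.+1).
by rewrite nth_uniform_partition // -natr1 mulrDr mulr1 addrA.
Qed.

Lemma young_sum_uniform (R : realType) (n d : nat) (g : R -> 'M[R]_(n, d))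
    (x : R -> 'cV[R]_d) (a b : R) (m : nat) :
  young_sum g x a b (uniform_partition a b m) = uniform_sum g x a b m.
Proof.
rewrite /young_sum size_uniform_partition; apply: eq_big_nat => i /andP[_ im].
by rewrite !nth_uniform_partition // ltnW.
Qed.

Lemma uniform_itv_partition (R : realType) (a b : R) (m : nat) : a < b -> (0 < m)%N ->
  itv_partition a b (uniform_partition a b m).
Proof.
move=> ab m_gt0; split; last by rewrite last_uniform_partition.
apply: path_uniform_partition => u.
by rewrite ltrDl divr_gt0 ?subr_gt0 ?ltr0n.
Qed.

Lemma mesh_uniform_partition (R : realType) (a b delta : R) (m : nat) :
  (b - a) / m%:R < delta -> path (fun u v => v - u < delta) a (uniform_partition a b m).
Proof. by move=> bam; apply: path_uniform_partition => u; rewrite addrC addKr. Qed.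

Lemma big_nat_double (V : nmodType) (m : nat) (F : nat -> V) :
  \sum_(0 <= i < m.*2) F i = \sum_(0 <= i < m) (F i.*2 + F i.*2.+1).
Proof.
elim: m => [|m IHm]; first by rewrite !big_geq.
by rewrite doubleS !big_nat_recr //= IHm addrA.
Qed.

(** * Estimates of uniform sums *)

Lemma powR_natM (R : realType) (m : nat) (r : R) : (0 < m)%N ->
  m%:R * m%:R `^ (- r) = m%:R `^ (1 - r) :> R.
Proof.
move=> m_gt0; rewrite powRD ?powRr1 //.
by rewrite pnatr_eq0 -lt0n m_gt0 implybT.
Qed.

Lemma powR_div_nat (R : realType) (L r : R) (m : nat) : 0 <= L ->
  (L / m%:R) `^ r = L `^ r * m%:R `^ (- r).
Proof.
move=> L_ge0; rewrite powRM ?invr_ge0 //.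
by rewrite -powR_inv1 // -powRrM mulN1r.
Qed.

Lemma uniform_itv (R : realType) (a b : R) (m i : nat) : a < b ->
  (i <= m)%N -> a <= a + (b - a) / m%:R * i%:R <= b.
Proof.
move=> ab im; have L_gt0 : 0 < b - a by rewrite subr_gt0.
rewrite lerDl mulr_ge0 ?divr_ge0 ?(ltW L_gt0) //=.
case: m im => [|m] im.
  by move: im; rewrite leqn0 => /eqP ->; rewrite mulr0 addr0 ltW.
rewrite -lerBrDl mulrAC ler_pdivrMr ?ltr0n // ler_pM2l //.
by rewrite ler_nat.
Qed.

Lemma enorm_uniform_sum (R : realType) (n d : nat) (g : R -> 'M[R]_(n, d))
    (x : R -> 'cV[R]_d) (a b M X gam : R) (m : nat) :
  a < b -> (0 < m)%N -> (forall t, a <= t <= b -> enorm (g t) <= M) ->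
  holder_on gam a b X x ->
  enorm (uniform_sum g x a b m) <=
    M * X * (b - a) `^ gam * m%:R `^ (1 - gam).
Proof.
move=> ab m_gt0 gM xX; apply: le_trans (enorm_sum _ _ _) _.
have -> : M * X * (b - a) `^ gam * m%:R `^ (1 - gam) =
    \sum_(0 <= i < m) (M * (X * ((b - a) / m%:R) `^ gam)).
  rewrite sumr_const_nat subn0 -[RHS]mulr_natl powR_div_nat ?subr_ge0 ?(ltW ab) //.
  by rewrite -powR_natM //; ring.
apply: ler_sum_nat => i /andP[_ im].
apply: le_trans (enormM _ _) _.
apply: ler_pM; rewrite ?enorm_ge0 ?gM ?uniform_itv // 1?ltnW //.
have h_gt0 : 0 < (b - a) / m%:R by rewrite divr_gt0 ?subr_gt0 ?ltr0n.
rewrite -[X in X `^ gam](_ : a + (b - a) / m%:R * i.+1%:R -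
  (a + (b - a) / m%:R * i%:R) = _); last first.
  by rewrite -natr1; ring.
apply: xX; rewrite ?uniform_itv // 1?ltnW //.
by rewrite ltrD2l ltr_pM2l // ltr_nat.
Qed.

(** Inserting the midpoint v of a piece [u, w] changes its term by (g v - g u)(x w - x v), a product
    of a lam-Hölder and a gam-Hölder increment. *)
Lemma uniform_sum_double (R : realType) (n d : nat) (g : R -> 'M[R]_(n, d))
    (x : R -> 'cV[R]_d) (a b G X lam gam : R) (m : nat) :
  a < b -> (0 < m)%N -> 0 <= G -> 0 <= X -> 0 <= lam + gam ->
  holder_on lam a b G g -> holder_on gam a b X x ->
  enorm (uniform_sum g x a b m.*2 - uniform_sum g x a b m) <=
    G * X * (b - a) `^ (lam + gam) * m%:R `^ (1 - (lam + gam)).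
Proof.
move=> ab m_gt0 G_ge0 X_ge0 lg_ge0 gG xX.
have L_gt0 : 0 < b - a by rewrite subr_gt0.
pose e := (b - a) / m.*2%:R.
have e_gt0 : 0 < e by rewrite divr_gt0 ?ltr0n ?double_gt0.
have m2E : (b - a) / m%:R = e * 2.
  rewrite /e -muln2 natrM invfM; field.
  by rewrite pnatr_eq0 -lt0n.
pose t i := a + e * i%:R.
have t_itv i : (i <= m.*2)%N -> a <= t i <= b by move=> im; exact: uniform_itv.
have t_step i : t i.+1 - t i = e by rewrite /t -natr1; ring.
have t_lt i : t i < t i.+1 by rewrite -subr_gt0 t_step.
have -> : uniform_sum g x a b m.*2 - uniform_sum g x a b m =
    \sum_(0 <= i < m) ((g (t i.*2.+1) - g (t i.*2)) *m
      (x (t i.*2.+2) - x (t i.*2.+1))).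
  rewrite /uniform_sum big_nat_double -sumrB; apply: eq_bigr => i _.
  rewrite -/e m2E -/(t i.*2) -/(t i.*2.+1) -/(t i.*2.+2).
  have -> : a + e * 2 * i%:R = t i.*2 by rewrite /t -muln2 natrM; ring.
  have -> : a + e * 2 * i.+1%:R = t i.*2.+2.
    by rewrite /t -doubleS -muln2 natrM; ring.
  rewrite -[x (t i.*2.+2) - x (t i.*2)](subrKA (x (t i.*2.+1))).
  move: (x _ - x (t i.*2.+1)) (x _ - x _) => Q P.
  rewrite mulmxDr mulmxBl [X in _ - X]addrC opprD addrACA.
  by rewrite subrr add0r.
apply: le_trans (enorm_sum _ _ _) _.
apply: (@le_trans _ _ (\sum_(0 <= i < m) (G * e `^ lam * (X * e `^ gam)))).
  apply: ler_sum_nat => i /andP[_ im]; apply: le_trans (enormM _ _) _.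
  have i2m : (i.*2.+2 <= m.*2)%N by rewrite -doubleS leq_double.
  have i1m := ltnW i2m; have i0m := ltnW i1m.
  apply: ler_pM; rewrite ?enorm_ge0 //.
    by rewrite -(t_step i.*2); apply: gG; rewrite ?t_itv.
  by rewrite -(t_step i.*2.+1); apply: xX; rewrite ?t_itv.
rewrite sumr_const_nat subn0 -[leLHS]mulr_natl mulrACA -powRD; last first.
  by rewrite (gt_eqF e_gt0) implybT.
have -> : G * X * (b - a) `^ (lam + gam) * m%:R `^ (1 - (lam + gam)) =
    m%:R * (G * X * ((b - a) / m%:R) `^ (lam + gam)).
  by rewrite powR_div_nat ?(ltW L_gt0) // -powR_natM //; ring.
(* The half step [e] is crudely replaced by the full step [e * 2]. *)
rewrite ler_wpM2l // ler_wpM2l ?mulr_ge0 // m2E.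
by apply: ge0_ler_powR; rewrite ?nnegrE //; lra.
Qed.

(** The doubling errors form a geometric series of ratio [q], and [q < 1] because [lam + gam]
    exceeds 1; the bound does not depend on [k]. *)
Lemma uniform_sum_dyadic (R : realType) (n d : nat) (g : R -> 'M[R]_(n, d))
    (x : R -> 'cV[R]_d) (a b G X lam gam : R) (m k : nat) :
  a < b -> (0 < m)%N -> 0 <= G -> 0 <= X -> 1 < lam + gam ->
  holder_on lam a b G g -> holder_on gam a b X x ->
  enorm (uniform_sum g x a b (2 ^ k * m) - uniform_sum g x a b m) <=
    (1 - 2 `^ (1 - (lam + gam)))^-1 *
    (G * X * (b - a) `^ (lam + gam) * m%:R `^ (1 - (lam + gam))).
Proof.
move=> ab m_gt0 G_ge0 X_ge0 lg_gt1 gG xX.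
set q := 2 `^ _; set A := G * X * _.
have A_ge0 : 0 <= A by rewrite !mulr_ge0 ?powR_ge0.
have q_lt1 : 0 < 1 - q.
  rewrite subr_gt0 /q -[ltRHS](powRr0 2) /powR pnatr_eq0 /= ltr_expR.
  by rewrite ltr_pM2r ?subr_lt0 // ln_gt0 // ltr1n.
elim: k m m_gt0 => [|k IHk] m m_gt0.
  by rewrite mul1n subrr enorm0 !mulr_ge0 ?powR_ge0 ?invr_ge0 ?(ltW q_lt1).
(* The first doubling is split off, and the induction hypothesis is used at [m.*2]. *)
rewrite expnSr -mulnA mul2n.
rewrite -(subrKA (uniform_sum g x a b m.*2)).
apply: le_trans (enormD _ _) _.
have := IHk m.*2; rewrite double_gt0 => /(_ m_gt0).
rewrite -[in m.*2%:R]mul2n natrM powRM // -/q => IH.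
have := uniform_sum_double ab m_gt0 G_ge0 X_ge0 _ gG xX; rewrite -/A.
move=> /(_ (ltW (lt_trans ltr01 lg_gt1))) DB.
apply: le_trans (lerD IH DB) _.
set p := m%:R `^ _.
(* Equality holds: q / (1 - q) + 1 = 1 / (1 - q). *)
by rewrite le_eqVlt; apply/orP; left; apply/eqP; field; rewrite gt_eqF.
Qed.

(** * From uniform sums to the Young integral *)

Lemma small_dyadic_step (R : realType) (L delta : R) (m : nat) :
  0 < delta -> (0 < m)%N -> exists k : nat, L / (2 ^ k * m)%:R < delta.
Proof.
move=> delta_gt0 m_gt0.
have [k] : exists k : nat, L / delta < k%:R.
  exists (Num.bound `|L / delta|); apply: le_lt_trans (ler_norm _) _.
  exact: archi_boundP.
move=> kL; exists k.
rewrite ltr_pdivrMr ?ltr0n ?muln_gt0 ?expn_gt0 ?m_gt0 //.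
rewrite mulrC -ltr_pdivrMr // (lt_le_trans kL) // ler_nat.
by rewrite (leq_trans (ltnW (ltn_expl k (ltnSn 1)))) // leq_pmulr.
Qed.

Lemma fine_partition (R : realType) (a b delta : R) : a <= b -> 0 < delta ->
  exists2 p : seq R, itv_partition a b p & path (fun u v => v - u < delta) a p.
Proof.
(* The degenerate interval, met for the integral from 0 to 0, has the empty partition. *)
rewrite le_eqVlt => /predU1P[<- _|ab delta_gt0]; first by exists [::].
have [k km] := small_dyadic_step (b - a) delta_gt0 (ltn0Sn 0).
exists (uniform_partition a b (2 ^ k * 1)).
  by apply: uniform_itv_partition; rewrite // muln1 expn_gt0.
exact: mesh_uniform_partition.
Qed.

(** The difference [J - I] stands for the integral over [s, t]. A fine partition p of [a, s]
    followed by the uniform partition q of [s, t] is a fine partition of [a, t], and the sum along q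
    is the sum along p ++ q minus the sum along p. *)
Lemma young_integral_uniform (R : realType) (n d : nat)
    (g : R -> 'M[R]_(n, d)) (x : R -> 'cV[R]_d) (a s t eps : R)
    (I J : 'cV[R]_n) (m : nat) :
  a <= s -> s < t -> (0 < m)%N -> 0 < eps ->
  is_young_integral g x a s I -> is_young_integral g x a t J ->
  exists k, enorm (uniform_sum g x s t (2 ^ k * m) - (J - I)) < eps.
Proof.
move=> as_ st m_gt0 eps_gt0 gI gJ.
have eps2_gt0 : 0 < eps / 2 by rewrite divr_gt0.
have [delta1 delta1_gt0 {}gI] := gI _ eps2_gt0.
have [delta2 delta2_gt0 {}gJ] := gJ _ eps2_gt0.
have delta_gt0 : 0 < Num.min delta1 delta2 by rewrite lt_min delta1_gt0.
have [p [p_path /eqP p_last] p_mesh] := fine_partition as_ delta_gt0.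
have [k km] := small_dyadic_step (t - s) delta_gt0 m_gt0.
have mk_gt0 : (0 < 2 ^ k * m)%N by rewrite muln_gt0 expn_gt0.
exists k; rewrite -young_sum_uniform.
have [q_path /eqP q_last] := uniform_itv_partition st mk_gt0.
have := mesh_uniform_partition km.
move: (uniform_partition _ _ _) q_path q_last => q q_path q_last q_mesh.
have pI : enorm (young_sum g x a s p - I) < eps / 2.
  apply: gI; first by split; rewrite ?p_last.
  apply/mesh_ltP; apply: sub_path p_mesh => u v.
  by rewrite lt_min => /andP[].
have pqJ : enorm (young_sum g x a t (p ++ q) - J) < eps / 2.
  apply: gJ; first by split; rewrite ?cat_path ?last_cat p_last ?p_path ?q_last.
  apply/mesh_ltP; rewrite cat_path p_last.
  by apply/andP; split; [move: p_mesh|move: q_mesh]; apply: sub_path => u v;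
    rewrite lt_min => /andP[].
move: pqJ; rewrite (young_sum_cat _ _ _ s) p_last => pqJ.
have -> : young_sum g x s t q - (J - I) =
    (young_sum g x a s p + young_sum g x s t q - J) +
    (I - young_sum g x a s p).
  by apply/matrixP => i j; rewrite !mxE; ring.
apply: le_lt_trans (enormD _ _) _.
by rewrite [X in _ + X]enorm_distC [ltRHS]splitr ltrD.
Qed.

(** Triangle inequality through the sums over m and 2^k m pieces; as neither bound depends on k, the
    error [eps] can tend to 0. *)
Lemma young_integral_bound (R : realType) (n d : nat)
    (g : R -> 'M[R]_(n, d)) (x : R -> 'cV[R]_d) (a s t M G X lam gam : R)
    (I J : 'cV[R]_n) (m : nat) :
  a <= s -> s < t -> (0 < m)%N -> 0 <= G -> 0 <= X -> 1 < lam + gam ->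
  (forall u, s <= u <= t -> enorm (g u) <= M) ->
  holder_on lam s t G g -> holder_on gam s t X x ->
  is_young_integral g x a s I -> is_young_integral g x a t J ->
  enorm (J - I) <= M * X * (t - s) `^ gam * m%:R `^ (1 - gam) +
    (1 - 2 `^ (1 - (lam + gam)))^-1 *
    (G * X * (t - s) `^ (lam + gam) * m%:R `^ (1 - (lam + gam))).
Proof.
move=> as_ st m_gt0 G_ge0 X_ge0 lg_gt1 gM gG xX gI gJ.
apply/ler_addgt0Pr => eps eps_gt0.
have [k kIJ] := young_integral_uniform as_ st m_gt0 eps_gt0 gI gJ.
have Sm := enorm_uniform_sum st m_gt0 gM xX.
have Skm := uniform_sum_dyadic k st m_gt0 G_ge0 X_ge0 lg_gt1 gG xX.
apply: le_trans (lerD (lerD Sm Skm) (ltW kIJ)).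
apply: le_trans (lerD (enormD _ _) (lexx _)).
rewrite subrKC [X in _ <= _ + X]enorm_distC.
by apply: le_trans (enormD _ _); rewrite subrKC.
Qed.

(** * Choice of the number of pieces *)

(** With b = gam + lam - 1, take m just above r = (D X)^(1/b), so that D X = r^b <= m^b. If gam >= 1
    or r <= 1, then m^(1 - gam) <= 2; otherwise m <= 2 r and the power of X is computed from r. *)
Lemma number_of_pieces (R : realType) (lam gam D X : R) :
  0 < lam -> 0 < gam -> 1 < lam + gam -> 0 <= D -> 0 <= X ->
  exists m : nat, [/\ (0 < m)%N, D * X * m%:R `^ (1 - (lam + gam)) <= 1 &
    X * m%:R `^ (1 - gam) <=
      2 * (1 + D `^ (lam / (gam + lam - 1) - 1)) *
      Num.max (X `^ (lam / (gam + lam - 1))) X].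
Proof.
move=> lam_gt0 gam_gt0 lg_gt1 D_ge0 X_ge0; set b := gam + lam - 1.
have b_gt0 : 0 < b by rewrite /b; lra.
have DX_ge0 : 0 <= D * X by rewrite mulr_ge0.
have [r [r_ge0 rE]] : exists r, 0 <= r /\ r = (D * X) `^ b^-1.
  by exists ((D * X) `^ b^-1); rewrite powR_ge0.
have /andP[mr rm] := truncn_itv r_ge0.
exists (Num.truncn r).+1; split=> //.
  have -> : 1 - (lam + gam) = - b by rewrite /b; ring.
  rewrite powRN ler_pdivrMr ?powR_gt0 // mul1r.
  have -> : D * X = r `^ b.
    by rewrite rE -powRrM mulVf ?powRr1 // gt_eqF.
  by apply: ge0_ler_powR; rewrite ?nnegrE // ltW.
rewrite -natr1; set k := (Num.truncn r)%:R in mr *.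
have k_ge0 : 0 <= k by rewrite /k.
set Q := lam / b.
(* This identity turns r^(1 - gam) into (D X)^(Q - 1), whence the exponent Q of X. *)
have QE : (1 - gam) = b * (Q - 1).
  by rewrite /Q mulrBr mulrCA divff ?gt_eqF // /b; ring.
set E := D `^ _; set Z := Num.max _ _.
have E_ge0 : 0 <= E by exact: powR_ge0.
have ZX : X <= Z by rewrite le_max lexx orbT.
have ZXQ : X `^ Q <= Z by rewrite le_max lexx.
have Z_ge0 := le_trans X_ge0 ZX.
have small c : c <= 2 -> X * c <= 2 * (1 + E) * Z.
  move=> c2; apply: le_trans (ler_wpM2l X_ge0 c2) _.
  by rewrite mulrC; apply: ler_pM => //; lra.
have [gam_ge1|gam_lt1] := lerP 1 gam.
  apply: small; apply: (@le_trans _ _ 1); last by lra.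
  by rewrite -[leRHS](powRr0 (k + 1)); apply: ler_powR; lra.
have two_le2 : 2 `^ (1 - gam) <= 2 :> R by apply: ler1_powR; lra.
have [r_le1|r_gt1] := lerP r 1.
  apply: small; apply: le_trans two_le2.
  by apply: ge0_ler_powR; rewrite ?nnegrE; lra.
have XrE : X * r `^ (1 - gam) = E * X `^ Q.
  rewrite rE -powRrM QE mulKf ?gt_eqF // powRM // mulrCA mulr_powRB1 //.
  by rewrite /Q divr_gt0.
have : (k + 1) `^ (1 - gam) <= 2 `^ (1 - gam) * r `^ (1 - gam).
  rewrite -powRM //.
  by apply: ge0_ler_powR; rewrite ?nnegrE; lra.
move=> /(ler_wpM2l X_ge0) /le_trans -> //.
rewrite mulrCA XrE -mulrA; apply: ler_pM => //; first by rewrite mulr_ge0 ?powR_ge0.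
rewrite mulrDl mul1r -[leLHS]add0r lerD //.
by rewrite ler_wpM2l.
Qed.

(** * The a priori estimate *)

(** The points t + r and s + r lie in [-h, T] at distance t - s. With the Lipschitz bound on f, this
    transfers the Hölder regularity of y to [f (segment y u)]. *)
Lemma sup_norm_segment_le (R : realType) (n : nat) (h T lam N s t : R)
    (y : R -> 'cV[R]_n) :
  0 <= s -> t <= T -> s < t -> holder_on lam (- h) T N y ->
  (sup_norm (- h) 0 (segment y t \- segment y s)%R <=
    (N * (t - s) `^ lam)%:E)%E.
Proof.
move=> s_ge0 tT st yN; apply: ge_ereal_sup => _ [r + <-].
rewrite /= in_itv /= => /andP[hr r0]; rewrite lee_fin /segment.
rewrite (_ : t - s = t + r - (s + r)); last by ring.
by apply: yN; lra.
Qed.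

Theorem proposition3p4 (R : realType) (gamma lambda M T : R)
    (gamma_gt : 2^-1 < gamma) (lambda_gt : 2^-1 < lambda)
    (lambda_lt : lambda < gamma) (M_gt0 : 0 < M) (T_gt0 : 0 < T) :
  exists2 c : R, 0 < c &
    forall (n d : nat) (h : R) (x : R -> 'cV[R]_d) (xi : R -> 'cV[R]_n)
           (f : (R -> 'cV[R]_n) -> 'M[R]_(n, d)) (y : R -> 'cV[R]_n),
      0 < h ->
      holder gamma 0 T x ->
      holder lambda (- h) 0 xi ->
      bounded_lipschitz lambda h M f ->
      locally_lipschitz_Uop lambda h T f ->
      delay_solution lambda h T x xi f y ->
      (holder_norm lambda (- h) T y <=
         c%:E * maxe (holder_norm lambda (- h) 0 xi)
                  (maxe (holder_norm gamma 0 T x `^ (lambda / (gamma + lambda - 1)))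
                        (holder_norm gamma 0 T x)))%E.
Proof.
have gamma_gt0 : 0 < gamma by lra.
have lambda_gt0 : 0 < lambda by lra.
have lg_gt1 : 1 < lambda + gamma by lra.
set C := (1 - 2 `^ (1 - (lambda + gamma)))^-1 : R.
have C_ge0 : 0 <= C.
  rewrite invr_ge0 subr_ge0 -[leRHS](powRr0 2).
  by apply: ler_powR; lra.
(* The factor 2 will leave at most half of N, and T^gamma dominates the power L^gamma of the length
   of any subinterval. *)
set D := 2 * C * M * T `^ gamma.
have D_ge0 : 0 <= D by rewrite !mulr_ge0 ?powR_ge0 // ltW.
set E := 2 * (1 + D `^ (lambda / (gamma + lambda - 1) - 1)).
have E_ge0 : 0 <= E by rewrite mulr_ge0 // addr_ge0 // powR_ge0.
have ME_ge0 : 0 <= M * T `^ (gamma - lambda) * E.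
  by rewrite mulr_ge0 // mulr_ge0 ?powR_ge0 // ltW.
(* The final inequality N <= Xi + K + N / 2, with K as set below, gives N <= 2 (Xi + K). *)
exists (2 * (1 + M * T `^ (gamma - lambda) * E)); first by lra.
move=> n d h x xi f y h_gt0 hx hxi [fM fL] _ [[hy y_xi] y_int _].
rewrite sub0r in hy y_xi.
have [X XE] := holder_norm_fin hx.
have [Xi XiE] := holder_norm_fin hxi.
have [N NE] := holder_norm_fin hy.
have /holder_norm_leP[X_ge0 xX] : (holder_norm gamma 0 T x <= X%:E)%E by rewrite XE.
have /holder_norm_leP[Xi_ge0 xiXi] :
  (holder_norm lambda (- h) 0 xi <= Xi%:E)%E by rewrite XiE.
have /holder_norm_leP[N_ge0 yN] : (holder_norm lambda (- h) T y <= N%:E)%E by rewrite NE.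
rewrite XE XiE poweR_EFin -!EFin_max -EFinM.
set Z := Num.max (X `^ _) X.
have [m [m_gt0 DXm Xm]] := number_of_pieces lambda_gt0 gamma_gt0 lg_gt1 D_ge0 X_ge0.
rewrite -/E -/Z in Xm.
have seg u : 0 <= u <= T -> holder lambda (- h) 0 (segment y u).
  by move=> /andP[u0 uT]; apply: holder_segment hy; lra.
set g := fun u => f (segment y u) in y_int.
have gM u : 0 <= u <= T -> enorm (g u) <= M by move=> /seg /fM.
have gN : holder_on lambda 0 T (M * N) g.
  move=> s t s0T t0T st; have := fL _ _ (seg s s0T) (seg t t0T).
  move: s0T t0T => /andP[s0 sT] /andP[t0 tT].
  rewrite -lee_fin -mulrA EFinM => /le_trans; apply.
  by apply: lee_wpmul2l; [rewrite lee_fin ltW|exact: (sup_norm_segment_le s0 tT st yN)].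
have X_m_ge0 : 0 <= X * m%:R `^ (1 - gamma) by rewrite mulr_ge0 ?powR_ge0.
set K := M * T `^ (gamma - lambda) * E * Z.
have y_pos s t : 0 <= s -> t <= T -> s < t ->
    enorm (y t - y s) <= (K + N / 2) * (t - s) `^ lambda.
  move=> s0 tT st.
  have s0T : 0 <= s <= T by lra.
  have t0T : 0 <= t <= T by lra.
  have [I gI ->] := y_int _ s0T; have [J gJ ->] := y_int _ t0T.
  rewrite opprD addrACA subrr add0r; set L := t - s.
  have L_gt0 : 0 < L by rewrite subr_gt0.
  have sub u : s <= u <= t -> 0 <= u <= T by move=> ?; lra.
  have MN_ge0 : 0 <= M * N by rewrite mulr_ge0 // ltW.
  have gMst u : s <= u <= t -> enorm (g u) <= M by move=> /sub /gM.
  have gNst : holder_on lambda s t (M * N) g by move=> u v /sub ? /sub; exact: gN.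
  have xXst : holder_on gamma s t X x by move=> u v /sub ? /sub; exact: xX.
  have := young_integral_bound s0 st m_gt0 MN_ge0 X_ge0 lg_gt1 gMst gNst xXst gI gJ.
  rewrite -/L -/C => /le_trans; apply.
  have LT r : 0 <= r -> L `^ r <= T `^ r.
    by move=> r0; apply: ge0_ler_powR; rewrite ?nnegrE /L; lra.
  have LE r : L `^ (lambda + r) = L `^ lambda * L `^ r.
    by rewrite powRD // (gt_eqF L_gt0) implybT.
  rewrite mulrDl; apply: lerD.
    (* The single-sum term: a factor L^lambda is kept and L^(gamma - lambda) is bounded by T^(gamma
       - lambda). *)
    rewrite -[in L `^ gamma](subrKC lambda gamma) LE.
    set a := L `^ lambda; set m' := m%:R `^ _ in X_m_ge0 Xm *.
    have -> : M * X * (a * L `^ (gamma - lambda)) * m' =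
      M * L `^ (gamma - lambda) * (X * m') * a by ring.
    rewrite /K -[_ * E * Z]mulrA ler_wpM2r ?powR_ge0 //.
    apply: ler_pM => //; first by rewrite mulr_ge0 ?powR_ge0 // ltW.
    by rewrite ler_wpM2l ?(ltW M_gt0) // LT; lra.
  (* The refinement term: the choice of m makes D X m^(1 - (lambda + gamma)) at most 1, so N / 2
     times L^lambda remains. *)
  rewrite LE; set a := L `^ lambda; set m' := m%:R `^ _ in DXm *.
  have -> : C * (M * N * X * (a * L `^ gamma) * m') =
    C * M * N * X * m' * a * L `^ gamma by ring.
  apply: (@le_trans _ _ (C * M * N * X * m' * a * T `^ gamma)).
    rewrite ler_wpM2l ?LT //; last by lra.
    by rewrite !mulr_ge0 ?powR_ge0 // ltW.
  have -> : C * M * N * X * m' * a * T `^ gamma = D * X * m' * (N / 2 * a).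
    by rewrite /D; field.
  by rewrite ler_piMl // mulr_ge0 ?powR_ge0 // divr_ge0.
(* Since N is exactly the norm of y and is finite, N / 2 can be subtracted from both sides. *)
suff yB : (holder_norm lambda (- h) T y <= (Xi + (K + N / 2))%:E)%E.
  rewrite NE lee_fin in yB; rewrite NE lee_fin.
  have ZZ : Z <= Num.max Xi Z by rewrite le_max lexx orbT.
  have XZ : Xi <= Num.max Xi Z by rewrite le_max lexx.
  have KZ : K <= M * T `^ (gamma - lambda) * E * Num.max Xi Z by rewrite ler_wpM2l.
  lra.
have K_ge0 : 0 <= K by rewrite mulr_ge0 // le_max X_ge0 orbT.
apply/holder_norm_leP; split; first by lra.
move=> s t sT tT st; have L_ge0 := powR_ge0 (t - s) lambda.
(* Pairs on one side of 0 are controlled by [y_pos] or by [xi]; a pair straddling 0 is split there,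
   and the two constants add up. *)
have [s_ge0|s_lt0] := lerP 0 s.
  have := y_pos s t s_ge0 ltac:(lra) st; nra.
have [t_le0|t_gt0] := lerP t 0.
  rewrite !y_xi; try lra.
  have := xiXi s t ltac:(lra) ltac:(lra) st; nra.
have mono r : 0 <= r <= t - s -> r `^ lambda <= (t - s) `^ lambda.
  by move=> ?; apply: ge0_ler_powR; rewrite ?nnegrE; lra.
have y0s : enorm (y 0 - y s) <= Xi * (t - s) `^ lambda.
  rewrite !y_xi; try lra.
  have := xiXi s 0 ltac:(lra) ltac:(lra) s_lt0.
  have := mono (0 - s) ltac:(lra); nra.
have yt0 : enorm (y t - y 0) <= (K + N / 2) * (t - s) `^ lambda.
  have := y_pos 0 t ltac:(lra) ltac:(lra) t_gt0.
  have := mono (t - 0) ltac:(lra); nra.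
rewrite -(subrKA (y 0)); apply: le_trans (enormD _ _) _.
by rewrite mulrDl addrC lerD.
Qed.
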